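(* There exists a $3$-connected planar graph $G$ that is not a complete graph and that is not degree-truncated $8$-choosable.
   Context: All graphs are finite and simple. A list assignment $L$ of a graph $G$ assigns to each vertex $v$ a set $L(v)$ of colours; an $L$-colouring is a map $\phi$ with $\phi(v)\in L(v)$ for all $v$ and $\phi(u)\neq\phi(v)$ for every edge $uv$. For $f:V(G)\to\mathbb{N}$, an $f$-list assignment is a list assignment with $|L(v)|\ge f(v)$ for all $v$, and $G$ is $f$-choosable if it is $L$-colourable for every $f$-list assignment $L$. For a positive integer $k$, $G$ is degree-truncated $k$-choosable if $G$ is $f$-choosable for $f(v)=\min\{k,d_G(v)\}$, where $d_G(v)$ is the degree of $v$ in $G$. *)

(* Defs.v *)
From mathcomp Require Import all_boot.
From Stdlib Require Import Reals.

Set Implicit Arguments.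
Unset Strict Implicit.
Unset Printing Implicit Defensive.

Definition simple_graph (T : finType) (e : rel T) : Prop :=
  symmetric e /\ irreflexive e.

Definition deg (T : finType) (e : rel T) (v : T) : nat := #|[set u | e v u]|.

Definition complete (T : finType) (e : rel T) : Prop :=
  forall u v : T, u != v -> e u v.

Definition connected_without (T : finType) (e : rel T) (X : {set T}) : Prop :=
  forall u v : T, u \notin X -> v \notin X ->
    connect [rel x y | [&& e x y, x \notin X & y \notin X]] u v.

Definition k_connected (k : nat) (T : finType) (e : rel T) : Prop :=
  k < #|T| /\ forall X : {set T}, #|X| < k -> connected_without e X.

Definition pt := (R * R)%type.

Definition curve_continuous (g : R -> pt) : Prop :=
  forall t : R, (0 <= t <= 1)%R ->
  forall eps : R, (0 < eps)%R -> exists delta : R, (0 < delta)%R /\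
    forall s : R, (0 <= s <= 1)%R -> (Rabs (s - t) < delta)%R ->
      (Rabs (fst (g s) - fst (g t)) < eps)%R /\
      (Rabs (snd (g s) - snd (g t)) < eps)%R.

Definition jordan_arc (g : R -> pt) : Prop :=
  curve_continuous g /\
  forall s t : R, (0 <= s <= 1)%R -> (0 <= t <= 1)%R -> g s = g t -> s = t.

Definition planar_embedding (T : finType) (e : rel T)
    (pos : T -> pt) (arc : T -> T -> R -> pt) : Prop :=
  injective pos /\
  (forall u v : T, e u v ->
     jordan_arc (arc u v) /\ arc u v 0%R = pos u /\ arc u v 1%R = pos v /\
     (forall t : R, (0 < t < 1)%R -> forall w : T, arc u v t <> pos w)) /\
  (forall u v u' v' : T, e u v -> e u' v' ->
     ~ ((u = u' /\ v = v') \/ (u = v' /\ v = u')) ->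
     forall s t : R, (0 < s < 1)%R -> (0 < t < 1)%R ->
       arc u v s <> arc u' v' t).

Definition planar (T : finType) (e : rel T) : Prop :=
  exists (pos : T -> pt) (arc : T -> T -> R -> pt), planar_embedding e pos arc.

(* L-colouring: colours are natural numbers, lists are finite sets given as
   sequences *)
Definition L_colouring (T : finType) (e : rel T) (L : T -> seq nat)
    (phi : T -> nat) : Prop :=
  (forall v, phi v \in L v) /\ (forall u v, e u v -> phi u != phi v).

Definition L_colourable (T : finType) (e : rel T) (L : T -> seq nat) : Prop :=
  exists phi : T -> nat, L_colouring e L phi.

Definition f_list_assignment (T : finType) (f : T -> nat) (L : T -> seq nat)
  : Prop := forall v, f v <= size (undup (L v)).

Definition f_choosable (T : finType) (e : rel T) (f : T -> nat) : Prop :=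
  forall L : T -> seq nat, f_list_assignment f L -> L_colourable e L.

Definition degree_truncated_choosable (k : nat) (T : finType) (e : rel T)
  : Prop := f_choosable e (fun v => minn k (deg e v)).

(* Main.v *)
(** Two hubs, with lists 0..7 and 8..15, see a row of spine vertices, and each
    of the 64 colourings of the hubs is killed by its own group of three
    consecutive spine vertices, whose lists are the two hub colours plus 17..22.
    Between two consecutive spine vertices there are, on the side of either hub,
    two triangles joined by an edge; one triangle is completely joined to the left
    spine vertex and the other to the right one, and each has a vertex adjacent
    to the hub.  Around a spine vertex coloured in a set G of three colours, a
    triangle with lists G, G + hub colour, G + 23 is forced to put 23 on its link
    vertex, so the two triangles cannot both be forced.  The middle spine vertex
    of a group is thus killed on 17..19 from the left and on 20..22 from the right:
    whichever half of 17..22 contains the colour of the outer spine vertex, one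
    of the two sides has its triangle forced.

    The planar drawing is straight-line: seen from a hub, it is a projective image
    of a periodic strip, so noncrossing reduces by shears to a single cell, where
    pairs of edges are separated by lines of finitely many slopes. *)

Require Import Defs.
From mathcomp Require Import all_boot.
From mathcomp Require Import zify.
From Stdlib Require Import ZArith Reals Lra.

Set Implicit Arguments.
Unset Strict Implicit.
Unset Printing Implicit Defensive.

(** * The graph *)

Definition role : finType := option bool.
Notation Apex := None (only parsing).
Notation Core := (Some false).
Notation Link := (Some true).

Definition vertex (N : nat) : finType :=
  (bool + 'I_N.+1 + 'I_N * bool * bool * role)%type.
Notation Hub s := (inl (inl s)).
Notation Spine i := (inl (inr i)).
Notation Inner j s h k := (inr (j, s, h, k)).

(* [Inner j s h k]: the vertex with role [k] of the triangle in cell [j], on the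
   side of hub [s], near the left ([h = false]) or right spine vertex of the cell. *)
Definition half_edge N (x y : vertex N) : bool :=
  match x, y with
  | Hub _, Spine _ => true
  | Hub s, Inner _ s' _ k => (s == s') && (k == Apex)
  | Spine i, Inner j _ h _ => i == j + h :> nat
  | Inner j s h k, Inner j' s' h' k' =>
      [&& j == j', s == s' &
          if h == h' then k != k' else (k == Link) && (k' == Link)]
  | _, _ => false
  end.

Definition edge N : rel (vertex N) :=
  fun x y => half_edge x y || half_edge y x.

Lemma edge_sym N : symmetric (@edge N).
Proof. by move=> x y; rewrite /edge orbC. Qed.

Lemma edge_irr N : irreflexive (@edge N).
Proof. by case=> [[s|i]|[[[j s] h] k]] //; rewrite /edge /= !eqxx. Qed.

(** Here [j + h <= N], so [inord] never takes its default value. *)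
Definition foot N (j : 'I_N) (h : bool) : vertex N := Spine (inord (j + h)).

Lemma edge_foot N (j : 'I_N) s h k : edge (Inner j s h k) (foot j h).
Proof.
rewrite /edge /foot /= inordK ?eqxx //; case: j h => [j jN] [] /=; lia.
Qed.

Lemma foot_neq N (j : 'I_N) h : (foot j (~~ h) == foot j h) = false.
Proof.
apply/negP => /eqP[/(congr1 val)]; rewrite /= !inordK; first by case: h; lia.
all: by case: h (ltn_ord j) => /=; lia.
Qed.

(** * Connectivity *)

Lemma small_set3 (T : finType) (X : {set T}) (a b c : T) :
  #|X| < 3 -> a \in X -> b \in X -> uniq [:: a; b; c] -> c \notin X.
Proof.
move=> ltX aX bX U; apply/negP => cX; move: ltX; rewrite ltnNge => /negP; apply.
have <- : #|[:: a; b; c]| = 3 by apply/card_uniqP.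
by apply/subset_leq_card/subsetP => x; rewrite !inE => /or3P[] /eqP->.
Qed.

Section Connectivity.

Variables (N : nat) (X : {set vertex N}).
Hypotheses (N_gt1 : 1 < N) (ltX : #|X| < 3).

Let r := [rel x y | [&& edge x y, x \notin X & y \notin X]].

Lemma live_edge_sym : connect_sym r.
Proof.
by apply: sym_connect_sym => x y; rewrite /= edge_sym; congr andb; rewrite andbC.
Qed.

Lemma live_connect1 x y : edge x y -> x \notin X -> y \notin X -> connect r x y.
Proof. by move=> exy xX yX; apply: connect1; rewrite /= exy xX. Qed.

(** Two deletions cannot hit all of the spine vertices 0, 1, 2, which exist since [1 < N]. *)
Lemma live_spine : exists i : 'I_N.+1, Spine i \notin X.
Proof.
have [b0|] := boolP ((Spine (inord 0) : vertex N) \in X); last by exists (inord 0).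
have [b1|] := boolP ((Spine (inord 1) : vertex N) \in X); last by exists (inord 1).
exists (inord 2); apply: (small_set3 ltX b0 b1).
have D (a b : nat) : a <= N -> b <= N -> a != b ->
    (Spine (inord a) == Spine (inord b) :> vertex N) = false.
  by move=> la lb; apply: contraNF => /eqP[/(congr1 val)]; rewrite /= !inordK // => ->.
by rewrite /= !inE !D //; lia.
Qed.

Lemma hub_hub s s' : Hub s \notin X -> Hub s' \notin X -> connect r (Hub s) (Hub s').
Proof.
move=> sX s'X; have [i iX] := live_spine.
apply: (@connect_trans _ _ (Spine i)); first exact: live_connect1.
by apply: live_connect1 => //; rewrite edge_sym.
Qed.

Lemma inner_inner (j : 'I_N) (s h : bool) (k k' : role) :
    Inner j s h k \notin X -> Inner j s h k' \notin X ->
  connect r (Inner j s h k) (Inner j s h k').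
Proof.
have [->//|kk'] := eqVneq k k'.
by move=> kX k'X; apply: live_connect1 => //; rewrite /edge /= !eqxx kk'.
Qed.

(** A detour avoiding the triangle's own foot: over the edge between the two [Link] vertices. *)
Lemma inner_across (j : 'I_N) (s h : bool) (k : role) :
    Inner j s h k \notin X -> Inner j s h Link \notin X ->
    Inner j s (~~ h) Link \notin X -> foot j (~~ h) \notin X ->
  connect r (Inner j s h k) (foot j (~~ h)).
Proof.
move=> kX lX l'X fX; apply: (connect_trans (inner_inner kX lX)).
apply: (@connect_trans _ _ (Inner j s (~~ h) Link)).
  by apply: live_connect1 => //; rewrite /edge /= !eqxx; case: (h).
by apply: live_connect1 => //; exact: edge_foot.
Qed.

(** If the foot of an inner vertex is deleted, at most one more deletion remains; it cannot block
    both the detour over the links and the path through [Apex] and the hub of that side. *)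
Lemma connect_hub s x : Hub s \notin X -> x \notin X -> connect r x (Hub s).
Proof.
move=> sX; case: x => [[s'|i]|[[[j s'] h] k]] xX.
- exact: hub_hub.
- exact: live_connect1.
have [fX|fX] := boolP (foot j h \in X); last first.
  apply: (@connect_trans _ _ (foot j h)); last exact: live_connect1.
  by apply: live_connect1 => //; exact: edge_foot.
have across : Inner j s' h Link \notin X -> Inner j s' (~~ h) Link \notin X ->
    foot j (~~ h) \notin X -> connect r (Inner j s' h k) (Hub s).
  move=> lX l'X f'X; apply: (@connect_trans _ _ (foot j (~~ h))).
    exact: inner_across.
  exact: live_connect1.
(* Here [p] is the second deleted vertex, so [Apex] and [Hub s'] survive. *)
have through p : p \in X -> p != foot j h -> p != Inner j s' h Apex ->
    p != Hub s' -> connect r (Inner j s' h k) (Hub s).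
  move=> pX pf pa ps.
  have aX : Inner j s' h Apex \notin X.
    by apply: (small_set3 ltX fX pX); rewrite /= !inE negb_or eq_sym pf pa.
  have s'X : Hub s' \notin X.
    by apply: (small_set3 ltX fX pX); rewrite /= !inE negb_or eq_sym pf ps.
  apply: (connect_trans (inner_inner xX aX)).
  apply: (@connect_trans _ _ (Hub s')); last exact: hub_hub.
  by apply: live_connect1 => //; rewrite /edge /= !eqxx.
have [lX|lX] := boolP ((Inner j s' h Link : vertex N) \in X).
  apply: (through _ lX) => //; by apply/negP => /eqP[].
have [l'X|l'X] := boolP ((Inner j s' (~~ h) Link : vertex N) \in X).
  by apply: (through _ l'X) => //; apply/negP => /eqP[].
have [f'X|f'X] := boolP (foot j (~~ h) \in X); last exact: across.
by apply: (through _ f'X); rewrite ?foot_neq.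
Qed.

(** The hubs use up both deletions, so the walk along the spine through the links of successive
    cells is intact. *)
Lemma connect_spine (x : vertex N) :
  Hub false \in X -> Hub true \in X -> x \notin X -> connect r x (Spine ord0).
Proof.
move=> h0 h1.
have live (y : vertex N) : (if y is Hub _ then false else true) -> y \notin X.
  by move=> yH; apply: (small_set3 ltX h0 h1); rewrite /= !inE; case: y yH => [[]|].
have spine (i : nat) : i <= N -> connect r (Spine (inord i)) (Spine ord0).
  elim: i => [_|i IHi lti]; first by rewrite (_ : inord 0 = ord0) //; apply/val_inj; rewrite /= inordK.
  apply: connect_trans (IHi (ltnW lti)).
  have -> : (Spine (inord i.+1) : vertex N) = foot (Ordinal lti) true by rewrite /foot /= addn1.
  have -> : (Spine (inord i) : vertex N) = foot (Ordinal lti) (~~ true) by rewrite /foot /= addn0.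
  apply: (@connect_trans _ _ (Inner (Ordinal lti) true true Link)).
    by apply: live_connect1; rewrite ?live // edge_sym edge_foot.
  by apply: inner_across; rewrite ?live.
case: x => [[s|i]|[[[j s] h] k]] xX.
- by move: xX; case: s; rewrite ?h0 ?h1.
- by rewrite -(inord_val i) spine // -ltnS.
apply: (@connect_trans _ _ (foot j h)); last by apply: spine; case: h {xX} (ltn_ord j); lia.
by apply: live_connect1; rewrite ?live ?edge_foot.
Qed.

Lemma connected_without_small : connected_without (@edge N) X.
Proof.
move=> x y xX yX.
have root z : (forall t, t \notin X -> connect r t z) -> connect r x y.
  by move=> cz; apply: connect_trans (cz x xX) _; rewrite live_edge_sym cz.
have [h0|h0] := boolP (Hub false \in X); last by apply: (root (Hub false)) => t; apply: connect_hub.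
have [h1|h1] := boolP (Hub true \in X); last by apply: (root (Hub true)) => t; apply: connect_hub.
by apply: (root (Spine ord0)) => t; apply: connect_spine.
Qed.

End Connectivity.

Lemma edge_3connected N : 1 < N -> k_connected 3 (@edge N).
Proof.
move=> N_gt1; split; last by move=> X; apply: connected_without_small.
by rewrite !card_sum card_bool card_ord; lia.
Qed.

(** * Planarity *)

Section Segments.

Local Open Scope R_scope.

Definition segment (a b : pt) (t : R) : pt :=
  ((1 - t) * fst a + t * fst b, (1 - t) * snd a + t * snd b).

Lemma lipschitz_continuous (c d : R) (t eps : R) : 0 < eps ->
  exists delta, 0 < delta /\ forall s, Rabs (s - t) < delta ->
    Rabs (((1 - s) * c + s * d) - ((1 - t) * c + t * d)) < eps.
Proof.
move=> eps0; have K0 : 0 < Rabs (d - c) + 1 by have := Rabs_pos (d - c); lra.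
exists (eps / (Rabs (d - c) + 1)); split; first exact: Rdiv_lt_0_compat.
move=> s st.
have -> : (1 - s) * c + s * d - ((1 - t) * c + t * d) = (s - t) * (d - c) by ring.
rewrite Rabs_mult.
have := Rmult_lt_compat_r _ _ _ K0 st.
have -> : eps / (Rabs (d - c) + 1) * (Rabs (d - c) + 1) = eps by field; lra.
by have := Rabs_pos (s - t); nra.
Qed.

Lemma segment_continuous a b : curve_continuous (segment a b).
Proof.
move=> t _ eps eps0.
have [d1 [d1_gt0 H1]] := lipschitz_continuous (fst a) (fst b) t eps0.
have [d2 [d2_gt0 H2]] := lipschitz_continuous (snd a) (snd b) t eps0.
exists (Rmin d1 d2); split; first exact: Rmin_glb_lt.
by move=> s _ st; split; [apply: H1 | apply: H2]; apply: Rlt_le_trans st _;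
  [apply: Rmin_l | apply: Rmin_r].
Qed.

Lemma segment_jordan a b : a <> b -> jordan_arc (segment a b).
Proof.
move=> ab; split; first exact: segment_continuous.
move=> s t _ _ [E1 E2].
have [//|st] := Req_dec s t; case: ab.
by case: a b E1 E2 => [a1 a2] [b1 b2] /= E1 E2; congr pair; nra.
Qed.

End Segments.

(** A line weakly separates the two segments and misses at least one of the four ends. Shared ends
    are allowed, and so are degenerate segments, which stand for single vertices. *)
Definition separated (a b a' b' : Z * Z) : Prop :=
  exists A B C : Z, let f p := (A * fst p + B * snd p + C)%Z in
    [/\ (0 <= f a)%Z /\ (0 <= f b)%Z, (f a' <= 0)%Z /\ (f b' <= 0)%Z
      & (0 < f a + f b - f a' - f b')%Z].

Definition realpt (p : Z * Z) : pt := (IZR (fst p), IZR (snd p)).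

(** Interior points are combinations of the ends with positive weights, so an end off the line keeps
    its whole open segment strictly on its side. *)
Lemma separated_segments a b a' b' (s t : R) : separated a b a' b' ->
  (0 < s < 1)%R -> (0 < t < 1)%R ->
  segment (realpt a) (realpt b) s <> segment (realpt a') (realpt b') t.
Proof.
case=> A [B [C [[fa0 fb0] [fa'0 fb'0] f_lt]]] s01 t01 E.
move: fa0 fb0 fa'0 fb'0 f_lt E => /IZR_le + /IZR_le + /IZR_le + /IZR_le + /IZR_lt.
case: a b a' b' => [a1 a2] [b1 b2] [c1 c2] [d1 d2].
rewrite /realpt /segment /= !(minus_IZR, plus_IZR, mult_IZR).
move: (IZR A) (IZR B) (IZR C) (IZR a1) (IZR a2) (IZR b1) (IZR b2) => {}A {}B {}C {}a1 {}a2 {}b1 {}b2.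
move: (IZR c1) (IZR c2) (IZR d1) (IZR d2) => {}c1 {}c2 {}d1 {}d2 H1 H2 H3 H4 H5 [E1 E2].
set fa := (A * a1 + B * a2 + C)%R in H1 H5.
set fb := (A * b1 + B * b2 + C)%R in H2 H5.
set fc := (A * c1 + B * c2 + C)%R in H3 H5.
set fd := (A * d1 + B * d2 + C)%R in H4 H5.
have E : ((1 - s) * fa + s * fb = (1 - t) * fc + t * fd)%R.
  rewrite /fa /fb /fc /fd.
  transitivity (A * ((1 - s) * a1 + s * b1) + B * ((1 - s) * a2 + s * b2) + C)%R; first by ring.
  by rewrite E1 E2; ring.
have P x y z : (0 < z < 1 -> 0 <= x -> 0 <= y -> 0 < x + y -> 0 < (1 - z) * x + z * y)%R.
  move=> z01 x0 y0 xy; have [x_le0|x_gt0] := Rle_lt_dec x 0.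
    have z0 : (0 < z)%R by lra.
    have y_gt0 : (0 < y)%R by lra.
    by have := Rmult_lt_0_compat _ _ z0 y_gt0; nra.
  have z1 : (0 < 1 - z)%R by lra.
  by have := Rmult_lt_0_compat _ _ z1 x_gt0; nra.
have P0 x y z : (0 < z < 1 -> 0 <= x -> 0 <= y -> 0 <= (1 - z) * x + z * y)%R.
  by move=> z01 x0 y0; nra.
have [fab|fab] := Rlt_le_dec 0 (fa + fb).
  by have := P _ _ _ s01 H1 H2 fab; have := P0 (- fc)%R (- fd)%R t t01; lra.
by have := P0 _ _ _ s01 H1 H2; have := P (- fc)%R (- fd)%R t t01; lra.
Qed.

(* Names of the vertices seen from one side of a cell. *)
Definition code : finType := option (bool + bool * role)%type.
Notation LHub := None (only parsing).
Notation LSpine h := (Some (inl h)).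
Notation LInner h k := (Some (inr (h, k))).

Definition code_half_edge (p q : code) : bool :=
  match p, q with
  | LHub, LSpine _ => true
  | LHub, LInner _ k => k == Apex
  | LSpine h, LInner h' _ => h == h'
  | LInner h k, LInner h' k' =>
      if h == h' then k != k' else (k == Link) && (k' == Link)
  | _, _ => false
  end.

(** The case [p == q] makes a vertex a degenerate edge, so one separation statement also covers
    distinct vertices and vertices off edges. *)
Definition code_link (p q : code) : bool :=
  [|| p == q, code_half_edge p q | code_half_edge q p].

(** [LHub] ignores [j], [LSpine] ignores [s], and the right foot of a cell is the left foot of the
    next: these are the overlaps between cells. *)
Definition place N (j : 'I_N) (s : bool) (p : code) : vertex N :=
  match p with
  | LHub => Hub s
  | LSpine h => foot j h
  | LInner h k => Inner j s h k
  end.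

(** * Integer coordinates and separation within and between cells *)

Section Drawing.

Local Open Scope Z_scope.
Local Arguments Z.add : simpl never.
Local Arguments Z.sub : simpl never.
Local Arguments Z.mul : simpl never.

(* A vertex is drawn at (x d, 8 - d), with the hub (0, 8) at depth d = 0: lines
   x = const pass through the hub, and translating x is a shear fixing it. *)
Definition depth (p : code) : Z :=
  match p with
  | LHub => 0
  | LSpine _ => 8
  | LInner _ Apex => 2
  | LInner _ Core => 3
  | LInner _ Link => 4
  end.

Definition abscissa (p : code) : Z :=
  let fix_side (h : bool) c := if h then 8 - c else c in
  match p with
  | LHub => 0
  | LSpine h => fix_side h 0
  | LInner h Apex => fix_side h 1
  | LInner h Core => fix_side h 2
  | LInner h Link => fix_side h 3
  end.

Definition sgn (s : bool) : Z := if s then -1 else 1.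

(** Cell [j] fills the abscissae from 8j to 8j + 8; the spine lies on the axis y = 0, in which the
    two sides are mirror images. *)
Definition cell_pos (j : nat) (s : bool) (p : code) : Z * Z :=
  ((abscissa p + 8 * Z.of_nat j) * depth p, sgn s * (8 - depth p)).

Definition pos N (x : vertex N) : Z * Z :=
  match x with
  | Hub s => cell_pos 0 s LHub
  | Spine i => cell_pos i false (LSpine false)
  | Inner j s h k => cell_pos j s (LInner h k)
  end.

Lemma pos_place N (j : 'I_N) s p : pos (place j s p) = cell_pos j s p.
Proof.
case: p => [[h|[h k]]|] //; last by rewrite /cell_pos /depth !Z.mul_0_r.
rewrite /pos /place /foot /cell_pos inordK; last by case: h (ltn_ord j) => /=; lia.
by case: h; case: s; rewrite /cell_pos /depth /abscissa /sgn; congr pair; lia.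
Qed.

(* Normals of separating lines, found by a greedy search. *)
Definition directions : seq (Z * Z) :=
  [:: (-4, -12); (1, 3); (-1, -8); (1, 8); (-12, 4); (3, -1); (-2, -10); (1, 5);
      (-1, -11); (1, 9); (-12, -12); (-10, 12); (-1, -9); (1, -3); (1, 0); (1, 10)].

Definition split_by (a b a' b' d : Z * Z) : bool :=
  let g p := fst d * fst p + snd d * snd p in
  let m := Z.min (g a) (g b) in
  [&& g a' <=? m, g b' <=? m & g a' + g b' <? g a + g b].

Lemma split_separated a b a' b' d : split_by a b a' b' d -> separated a b a' b'.
Proof.
move=> /and3P[/Z.leb_le A /Z.leb_le B /Z.ltb_lt C].
exists (fst d), (snd d), (- Z.min (fst d * fst a + snd d * snd a)
                             (fst d * fst b + snd d * snd b)).
by split; [split| split|]; lia.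
Qed.

Definition codes : seq code :=
  [:: LHub; LSpine false; LSpine true]
  ++ [seq LInner h k | h <- [:: false; true], k <- [:: Apex; Core; Link]].

Lemma mem_codes p : p \in codes.
Proof. by case: p => [[[]|[[] [[]|]]]|]. Qed.

Lemma cell_check :
  let items := [seq pq <- [seq (p, q) | p <- codes, q <- codes] | code_link pq.1 pq.2] in
  all (fun u => all (fun v =>
    [|| u == v, u == (v.2, v.1) | has (split_by (cell_pos 0 false u.1) (cell_pos 0 false u.2)
       (cell_pos 0 false v.1) (cell_pos 0 false v.2)) directions]) items) items.
Proof. by vm_compute. Qed.

Lemma separated_sym a b a' b' : separated a b a' b' -> separated a' b' a b.
Proof.
case=> A [B [C [[fa fb] [fa' fb'] f_lt]]].
exists (- A), (- B), (- C); split; [split| split|]; lia.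
Qed.

Lemma has_ex (T : Type) (a : pred T) s : has a s -> exists x, a x.
Proof. by elim: s => //= x s IHs /orP[|/IHs//]; exists x. Qed.

Lemma cell_separated p q p' q' : code_link p q -> code_link p' q' ->
  [\/ p = p' /\ q = q', p = q' /\ q = p' | separated (cell_pos 0 false p)
    (cell_pos 0 false q) (cell_pos 0 false p') (cell_pos 0 false q')].
Proof.
move=> pq p'q'; have items (a b : code) : code_link a b ->
  (a, b) \in [seq ab <- [seq (a, b) | a <- codes, b <- codes] | code_link ab.1 ab.2].
  by move=> ab; rewrite mem_filter ab allpairs_f ?mem_codes.
have /allP/(_ _ (items _ _ pq))/allP/(_ _ (items _ _ p'q')) := cell_check.
case/or3P => [/eqP[-> ->]|/eqP[-> ->]|/has_ex[d /split_separated]].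
- by constructor 1.
- by constructor 2.
- by constructor 3.
Qed.

Lemma separated_cell (j : nat) s p q p' q' :
    separated (cell_pos 0 false p) (cell_pos 0 false q)
      (cell_pos 0 false p') (cell_pos 0 false q') ->
  separated (cell_pos j s p) (cell_pos j s q) (cell_pos j s p') (cell_pos j s q').
Proof.
case=> A [B [C]].
set f := (fun u => _) => -[fpq fpq' f_lt].
set jz := Z.of_nat j.
(* Cell [j] is the image of cell 0 under the shear (x, y) -> (x + 8j(8 - y), y), then the mirror;
   the line is transported along. *)
exists A, (sgn s * (B + 8 * A * jz)), (C - 64 * A * jz).
set g := (fun u => _).
have E r : g (cell_pos j s r) = f (cell_pos 0 false r).
  rewrite /g /f /cell_pos -/jz; move: (abscissa r) (depth r) => a d.
  by change (Z.of_nat 0) with 0; case: (s); cbv [fst snd sgn]; ring.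
by rewrite /= !E.
Qed.

Lemma separated_sides (j j' : nat) p q p' q' :
  ~~ all (fun r => depth r =? 8) [:: p; q; p'; q'] ->
  separated (cell_pos j false p) (cell_pos j false q)
    (cell_pos j' true p') (cell_pos j' true q').
Proof.
have D r : depth r <= 8 by case: r => [[h|[h [[]|]]]|].
(* The axis of the spine separates the sides. *)
move=> ne; exists 0, 1, 0; rewrite /cell_pos /sgn /=.
have := (D p, D q, D p', D q') => -[[[Dp Dq] Dp'] Dq'].
split; [split| split|]; try lia.
move: ne; rewrite /= andbT !negb_and.
by case/or4P => /negbTE/Z.eqb_neq; lia.
Qed.

(** The separating line joins the hub to the right foot of cell [j]. The excluded case is the one
    with all four ends on that line. *)
Lemma separated_cells (j j' : nat) s p q p' q' : (j < j')%nat ->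
  ~~ [&& p \in [:: LHub; LSpine true], q \in [:: LHub; LSpine true] &
      (p' == LHub) && (q' == LHub) ||
      [&& j' == j.+1, p' \in [:: LHub; LSpine false] & q' \in [:: LHub; LSpine false]]] ->
  separated (cell_pos j s p) (cell_pos j s q) (cell_pos j' s p') (cell_pos j' s q').
Proof.
move=> lt_jj' ne.
pose c0 := 8 * (Z.of_nat j + 1).
exists (-1), (- c0 * sgn s), (8 * c0).
set f := (fun u => _).
have E i r : f (cell_pos i s r) = (c0 - abscissa r - 8 * Z.of_nat i) * depth r.
  rewrite /f /cell_pos; move: (abscissa r) (depth r) => a d.
  by case: (s); cbv [fst snd sgn]; ring.
rewrite /= !E /c0 {E f c0}.
have L r : 0 <= (8 * (Z.of_nat j + 1) - abscissa r - 8 * Z.of_nat j) * depth r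
         /\ (r \notin [:: LHub; LSpine true] ->
             0 < (8 * (Z.of_nat j + 1) - abscissa r - 8 * Z.of_nat j) * depth r).
  by clear; case: r => [[[]|[[] [[]|]]]|]; rewrite !inE ?eqxx ?orbT /=; split=> // *; lia.
have R r : (8 * (Z.of_nat j + 1) - abscissa r - 8 * Z.of_nat j') * depth r <= 0
         /\ (~~ ((r == LHub) || (j' == j.+1) && (r == LSpine false)) ->
             (8 * (Z.of_nat j + 1) - abscissa r - 8 * Z.of_nat j') * depth r < 0).
  have lt1 : Z.of_nat j + 1 <= Z.of_nat j' by lia.
  have lt2 : j' != j.+1 -> Z.of_nat j + 2 <= Z.of_nat j' by lia.
  move: lt1 lt2; clear; move: (Z.of_nat j) (Z.of_nat j') => z z' lt1 lt2.
  by case: r => [[[]|[[] [[]|]]]|] /=; split=> //; rewrite ?eqxx ?andbT; try move/lt2; lia.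
move: (L p) (L q) (R p') (R q') ne; rewrite !inE; clear.
move: (_ * depth p) (_ * depth q) (_ * depth p') (_ * depth q') => P Q P' Q'.
move=> [p0 p1] [q0 q1] [p'0 p'1] [q'0 q'1] ne; split=> //.
have pos4 : 0 < P \/ 0 < Q \/ P' < 0 \/ Q' < 0 -> 0 < P + Q - P' - Q'.
  by move: p0 q0 p'0 q'0; clear; lia.
apply: pos4.
have [pb|/p1] := boolP ((p == LHub) || (p == LSpine true)); last by left.
have [qb|/q1] := boolP ((q == LHub) || (q == LSpine true)); last by right; left.
have [p'b|/p'1] := boolP ((p' == LHub) || (j' == j.+1) && (p' == LSpine false)); last by right; right; left.
right; right; right; apply: q'1.
move: p'b ne; rewrite pb qb; clear.
by case: (j' == _); case: (p' == None); case: (q' == None); case: (p' == _); case: (q' == _).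
Qed.

End Drawing.

Lemma code_linkC p q : code_link p q = code_link q p.
Proof. by rewrite /code_link eq_sym; congr orb; rewrite orbC. Qed.

Lemma spine_foot N (i : 'I_N.+1) : 0 < N -> exists j h, Spine i = foot (N := N) j h.
Proof.
move=> N_gt0; have [ltiN|leNi] := ltnP i N.
  exists (Ordinal ltiN), false; congr (Spine _); apply: val_inj.
  by rewrite /= addn0 inordK // ltnW.
(* The last spine vertex is no left foot; it is the right foot of the last cell. *)
have ltN : N.-1 < N by rewrite prednK.
exists (Ordinal ltN), true; congr (Spine _); apply: val_inj.
by rewrite /= inordK; have := ltn_ord i; lia.
Qed.

Lemma half_edge_place N (x y : vertex N) : 0 < N -> half_edge x y ->
  exists j s p q, [/\ x = place j s p, y = place j s q & code_link p q].
Proof.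
move=> N_gt0; case: x y => [[s|i]|[[[j s] h] k]] [[s'|i']|[[[j' s'] h'] k']] //=.
- by move=> _; have [j [h ->]] := spine_foot i' N_gt0; exists j, s, LHub, (LSpine h).
- by case/andP=> /eqP<- /eqP->; exists j', s, LHub, (LInner h' Apex).
- move/eqP=> Ei; exists j', s', (LSpine h'), (LInner h' k'); split=> //.
    by congr (Spine _); apply: val_inj; rewrite /= -Ei inord_val.
  by rewrite /code_link /= eqxx ?orbT.
- case/and3P=> /eqP<- /eqP<- hk; exists j, s, (LInner h k), (LInner h' k').
  by split=> //; rewrite /code_link /= hk ?orbT.
Qed.

Lemma edge_place N (x y : vertex N) : 0 < N -> x = y \/ edge x y ->
  exists j s p q, [/\ x = place j s p, y = place j s q & code_link p q].
Proof.
move=> N_gt0 [<-|/orP[]]; last 2 first.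
- exact: half_edge_place.
- move/(half_edge_place N_gt0) => [j [s [p [q [-> -> pq]]]]].
  by exists j, s, q, p; rewrite code_linkC.
have refl p : code_link p p by rewrite /code_link eqxx.
case: x => [[s|i]|[[[j s] h] k]].
- by exists (Ordinal N_gt0), s, LHub, LHub.
- by have [j [h ->]] := spine_foot i N_gt0; exists j, false, (LSpine h), (LSpine h).
- by exists j, s, (LInner h k), (LInner h k); split.
Qed.

(** * Separation of any two edges *)

Section Edges.

Variable N : nat.
Hypothesis N_gt0 : 0 < N.

Definition same_ends (x y x' y' : vertex N) : Prop := (x = x' /\ y = y') \/ (x = y' /\ y = x').

Lemma place_separated (j : 'I_N) s p q p' q' : code_link p q -> code_link p' q' ->
  same_ends (place j s p) (place j s q) (place j s p') (place j s q') \/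
  separated (pos (place j s p)) (pos (place j s q)) (pos (place j s p')) (pos (place j s q')).
Proof.
move=> pq p'q'; case: (cell_separated pq p'q') => [[-> ->]|[-> ->]|sep].
- by left; left.
- by left; right.
- by right; rewrite !pos_place; exact: separated_cell.
Qed.

Lemma place_separated_lt (j j' : 'I_N) s p q p' q' : j < j' -> code_link p q -> code_link p' q' ->
  same_ends (place j s p) (place j s q) (place j' s p') (place j' s q') \/
  separated (pos (place j s p)) (pos (place j s q)) (pos (place j' s p')) (pos (place j' s q')).
Proof.
move=> lt_jj' pq p'q'; case: (boolP [&& p \in [:: LHub; LSpine true], q \in [:: LHub; LSpine true] &
      (p' == LHub) && (q' == LHub) ||
      [&& j' == j.+1 :> nat, p' \in [:: LHub; LSpine false] & q' \in [:: LHub; LSpine false]]]); last first.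
  by move=> ne; right; rewrite !pos_place; exact: separated_cells.
case/and3P=> pR qR /orP[/andP[/eqP p'H /eqP q'H]|/and3P[/eqP jj' p'L q'L]].
  by subst p' q'; exact: (place_separated j s pq p'q').
(* All four ends lie on the line shared by cells [j] and [j'], so the first link can be renamed as
   one of cell [j']. *)
pose flip (r : code) : code := if r is LHub then LHub else LSpine false.
have flipE r : r \in [:: LHub; LSpine true] -> place j s r = place j' s (flip r).
  rewrite !inE => /orP[] /eqP-> //=; congr (inl (inr _)).
  by rewrite jj' addn0 addn1.
rewrite !flipE //; apply: place_separated => //.
by move: pR qR; rewrite !inE => /orP[] /eqP-> /orP[] /eqP->.
Qed.

Lemma same_ends_sym (x y x' y' : vertex N) : same_ends x y x' y' -> same_ends x' y' x y.
Proof. by case=> -[-> ->]; [left | right]. Qed.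

Lemma place_separated_side (j j' : 'I_N) s p q p' q' : code_link p q -> code_link p' q' ->
  same_ends (place j s p) (place j s q) (place j' s p') (place j' s q') \/
  separated (pos (place j s p)) (pos (place j s q)) (pos (place j' s p')) (pos (place j' s q')).
Proof.
move=> pq p'q'; case: (ltngtP j j') => [lt|lt|/val_inj<-].
- exact: place_separated_lt.
- case: (place_separated_lt s lt p'q' pq) => [/same_ends_sym|/separated_sym]; by [left | right].
- exact: place_separated.
Qed.

Lemma place_separated_sides (j j' : 'I_N) p q p' q' : code_link p q -> code_link p' q' ->
  same_ends (place j false p) (place j false q) (place j' true p') (place j' true q') \/
  separated (pos (place j false p)) (pos (place j false q))
    (pos (place j' true p')) (pos (place j' true q')).
Proof.
move=> pq p'q'.
have [|ne] := boolP (all (fun r => depth r =? 8)%Z [:: p; q; p'; q']); last first.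
  by right; rewrite !pos_place; exact: separated_sides.
have spine r : (depth r =? 8)%Z -> place j false r = place j true r.
  by case: r => [[h|[h [[]|]]]|].
by case/and5P=> /spine-> /spine-> _ _ _; exact: place_separated_side.
Qed.

Lemma edges_separated (x y x' y' : vertex N) : x = y \/ edge x y -> x' = y' \/ edge x' y' ->
  same_ends x y x' y' \/ separated (pos x) (pos y) (pos x') (pos y').
Proof.
move=> /(edge_place N_gt0)[j [s [p [q [-> -> pq]]]]].
move=> /(edge_place N_gt0)[j' [s' [p' [q' [-> -> p'q']]]]].
case: s s' => [] [].
- exact: place_separated_side.
- case: (place_separated_sides j' j p'q' pq) => [/same_ends_sym|/separated_sym]; by [left | right].
- exact: place_separated_sides.
- exact: place_separated_side.
Qed.

Lemma edge_planar : planar (@edge N).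
Proof.
pose rpos (x : vertex N) := realpt (pos x).
have half01 : (0 < / 2 < 1)%R by lra.
have constE (x : vertex N) t : segment (rpos x) (rpos x) t = rpos x.
  by rewrite /segment; case: (rpos x) => a b /=; congr pair; ring.
have rpos_inj : injective rpos.
  (* Vertices are degenerate edges; separation would make their constant segments differ at the
     parameter 1/2. *)
  move=> x y E; have [[[->]|[->]]//|] := @edges_separated x x y y (or_introl erefl) (or_introl erefl).
  by move/separated_segments/(_ half01 half01); rewrite !constE E.
have neq (x y : vertex N) : edge x y -> x <> y by move=> + E; rewrite E edge_irr.
exists rpos, (fun x y => segment (rpos x) (rpos y)); split=> //; split.
  move=> x y exy; split; first by apply: segment_jordan => /rpos_inj; exact: neq.
  split; first by rewrite /segment; case: (rpos x) => a b /=; congr pair; ring.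
  split; first by rewrite /segment; case: (rpos y) => a b /=; congr pair; ring.
  move=> t t01 w; rewrite -(constE w t).
  have [|] := @edges_separated x y w w (or_intror exy) (or_introl erefl).
    by move=> [] [E1 E2]; case: (neq _ _ exy); rewrite E1 E2.
  by move/separated_segments; exact.
move=> x y x' y' exy exy' ne s t s01 t01.
have [|] := @edges_separated x y x' y' (or_intror exy) (or_intror exy'); first by [].
by move/separated_segments; exact.
Qed.

End Edges.

(** * A bad list assignment *)

Section Colouring.

(** For [i < 64] the two values run through all pairs of hub colours, the base 8 digits of [i]. *)
Definition hub_colour (s : bool) (i : nat) : nat := if s then 8 + i %/ 8 else i %% 8.

Definition group (b : bool) : seq nat := iota (if b then 20 else 17) 3.

(* Cells 3i and 3i+1 surround the middle spine vertex 3i+1 of group i; their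
   triangles at the outer spine vertices use the colours [group s]. *)
Definition half_group (j : nat) (s h : bool) : bool :=
  if (j %% 3 == 0) == h then j %% 3 != 0 else s.

Definition lists (x : vertex 192) : seq nat :=
  match x with
  | Hub s => iota (if s then 8 else 0) 8
  | Spine j => [:: hub_colour false (j %/ 3), hub_colour true (j %/ 3) & iota 17 6]
  | Inner j s h k =>
      let G := group (half_group j s h) in
      match k with
      | None => hub_colour s (j %/ 3) :: G
      | Core => G
      | Link => 23 :: G
      end
  end.

Lemma deg_le (T : finType) (e : rel T) x (s : seq T) :
  (forall y, e x y -> y \in s) -> deg e x <= size s.
Proof.
move=> es; apply: leq_trans (card_size s).
by apply/subset_leq_card/subsetP => y; rewrite inE; exact: es.
Qed.

Definition inner_nbrs N (j : 'I_N) (s h : bool) (k : role) : seq (vertex N) :=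
  foot j h ::
  match k with
  | None => [:: Hub s; Inner j s h Core; Inner j s h Link]
  | Core => [:: Inner j s h Apex; Inner j s h Link]
  | Link => [:: Inner j s h Apex; Inner j s h Core; Inner j s (~~ h) Link]
  end.

Lemma mem_inner_nbrs N (j : 'I_N) s h k y :
  edge (Inner j s h k) y -> y \in inner_nbrs j s h k.
Proof.
rewrite /edge /inner_nbrs; case: y => [[s'|i]|[[[j' s'] h'] k']] /=.
- by case/andP=> /eqP<- /eqP->; rewrite !inE eqxx orbT.
- move=> /eqP E; rewrite inE; apply/orP; left; apply/eqP.
  by congr (Spine _); apply: val_inj; rewrite /= -E inord_val.
- by case/orP => /and3P[/eqP-> /eqP->];
    case: k k' h h' => [[]|] [[]|] [] [] //=; rewrite !inE ?eqxx ?orbT.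
Qed.

(** The bound includes 64, the index of the last spine vertex 192, which lies in no group; its
    colour 16 still avoids 17..22. *)
Lemma hub_colour_lt s (i : nat) : i <= 64 -> hub_colour s i < 17.
Proof. by rewrite /hub_colour; case: s; lia. Qed.

(** Hubs and spine vertices get 8 colours, the truncation value; an inner vertex gets one colour per
    entry of [inner_nbrs], which bounds its degree. *)
Lemma lists_size : f_list_assignment (fun v => minn 8 (deg (@edge 192) v)) lists.
Proof.
have big s j : j <= 192 -> hub_colour s (j %/ 3) < 17.
  by move=> lej; apply: hub_colour_lt; lia.
case=> [[s|i]|[[[j s] h] k]].
- by rewrite undup_id ?iota_uniq // size_iota geq_minl.
- rewrite undup_id ?geq_minl //.
  have li : i <= 192 by have := ltn_ord i; lia.
  rewrite /lists; have := (big false _ li, big true _ li).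
  case=> A B; rewrite cons_uniq cons_uniq iota_uniq inE !mem_iota.
  by move: A B; rewrite /hub_colour; lia.
have := deg_le (@mem_inner_nbrs _ j s h k).
have -> : size (inner_nbrs j s h k) = size (lists (Inner j s h k)) by case: k => [[]|].
rewrite undup_id; first exact: leq_trans (geq_minr _ _).
have lj : j <= 192 by exact: ltnW.
have := big s _ lj; rewrite /lists /group; case: k => [[]|]; case: (half_group _ _ _);
  rewrite ?cons_uniq ?iota_uniq ?mem_iota // !inE /=; lia.
Qed.

Section Forced.

Variable phi : vertex 192 -> nat.
Hypothesis phiP : L_colouring (@edge 192) lists phi.

Lemma phi_list v : phi v \in lists v. Proof. exact: phiP.1. Qed.

Lemma phi_edge u v : edge u v -> phi u != phi v. Proof. exact: phiP.2. Qed.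

(** [Apex] loses the hub colour. Without 23, the foot and the triangle would be a complete graph on
    four vertices coloured from the three colours of [G]. *)
Lemma forced_link (j : 'I_192) s h :
    phi (Hub s) = hub_colour s (j %/ 3) ->
    phi (foot j h) \in group (half_group j s h) ->
  phi (Inner j s h Link) = 23.
Proof.
move=> hubE footG; set G := group _ in footG.
have neq (k k' : role) : k != k' -> phi (Inner j s h k) != phi (Inner j s h k').
  by move=> kk'; apply: phi_edge; rewrite /edge /= !eqxx kk'.
have neqf k : phi (foot j h) != phi (Inner j s h k).
  by apply: phi_edge; rewrite edge_sym edge_foot.
have aG : phi (Inner j s h Apex) \in G.
  have := phi_list (Inner j s h Apex); rewrite inE -hubE => /orP[|//].
  by rewrite eq_sym => /negP[]; apply/negP/phi_edge; rewrite /edge /= !eqxx.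
have cG : phi (Inner j s h Core) \in G := phi_list (Inner j s h Core).
have := phi_list (Inner j s h Link); rewrite inE => /orP[/eqP//|lG].
have U : uniq [:: phi (foot j h); phi (Inner j s h Apex); phi (Inner j s h Core);
                  phi (Inner j s h Link)].
  by rewrite /= !inE !negb_or !neqf !neq.
suff : 4 <= size G by rewrite size_iota.
rewrite -/G in lG; clearbody G.
by apply: (uniq_leq_size U) => c; rewrite !inE => /or4P[] /eqP->.
Qed.

Lemma cell_not_both (j : 'I_192) s :
    phi (Hub s) = hub_colour s (j %/ 3) ->
    phi (foot j false) \in group (half_group j s false) ->
  phi (foot j true) \notin group (half_group j s true).
Proof.
move=> hubE f0; apply/negP => f1.
have : phi (Inner j s false Link) != phi (Inner j s true Link).
  by apply: phi_edge; rewrite /edge /= !eqxx.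
by rewrite !forced_link.
Qed.

Lemma no_colouring : False.
Proof.
pose a := phi (Hub false); pose b := phi (Hub true).
have ha : a < 8 by have := phi_list (Hub false); rewrite mem_iota.
have hb : 8 <= b < 16 by have := phi_list (Hub true); rewrite mem_iota.
(* The group that kills the hub colouring (a, b). *)
pose i := (b - 8) * 8 + a.
have i_lt : i < 64 by rewrite /i; lia.
have hubE s : phi (Hub s) = hub_colour s i.
  by rewrite /hub_colour /i; case: s; rewrite -/a -/b; lia.
have spine (d : nat) : d < 3 ->
    exists c : bool, phi (Spine (inord (3 * i + d))) \in group c.
  move=> d_lt.
  have E : (3 * i + d) %/ 3 = i by lia.
  have nh s : phi (Spine (inord (3 * i + d))) != hub_colour s i.
    by rewrite -hubE; apply: phi_edge.
  have := phi_list (Spine (inord (3 * i + d))).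
  set c := phi _ in nh *.
  rewrite /lists inordK; last by lia.
  rewrite E 2!in_cons (negPf (nh false)) (negPf (nh true)) mem_iota /= => H.
  by exists (20 <= c); rewrite /group mem_iota; case: leqP; lia.
have [m mP] := spine 1 isT; have [c0 c0P] := spine 0 isT; have [c2 c2P] := spine 2 isT.
case: m mP => mP.
(* Middle colour in 20..22: take the cell to its right, on the side [c2] whose triangle at the outer
   vertex uses that vertex's half. *)
- have lt : 3 * i + 1 < 192 by lia.
  have D : (3 * i + 1) %/ 3 = i by lia.
  have M : (3 * i + 1) %% 3 = 1 by lia.
  have := @cell_not_both (Ordinal lt) c2; rewrite /foot /half_group /= D M /=.
  by rewrite addn0 -addnA mP c2P hubE => /(_ erefl isT).
(* Middle colour in 17..19: symmetrically, the cell to its left on side [c0]. *)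
- have lt : 3 * i + 0 < 192 by lia.
  have D : (3 * i + 0) %/ 3 = i by lia.
  have M : (3 * i + 0) %% 3 = 0 by lia.
  have := @cell_not_both (Ordinal lt) c0; rewrite /foot /half_group /= D M /=.
  by rewrite !addn0 in c0P *; rewrite mP c0P hubE => /(_ erefl isT).
Qed.

End Forced.

End Colouring.

Theorem theorem1 :
  exists (T : finType) (e : rel T),
    simple_graph e /\ k_connected 3 e /\ planar e /\
    ~ complete e /\ ~ degree_truncated_choosable 8 e.
Proof.
(* 192 = 3 * 64: three spine vertices for each hub colouring. *)
exists (vertex 192), (@edge 192); split; first by split; [exact: edge_sym | exact: edge_irr].
split; first exact: edge_3connected.
split; first exact: edge_planar.
split; first by move=> /(_ (Hub false) (Hub true) isT).
by move=> /(_ _ lists_size)[phi /no_colouring].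
Qed.
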